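(* Let $k$ be a field with $\operatorname{char} k\neq 2$, let $L$ be a Lie algebra over $k$ with $\dim L=2$, and let $r\in L\otimes L$. Then the following are equivalent: $(L,[\ ],\Delta_r,r)$ is a triangular Lie bialgebra; $(L,[\ ],\Delta_r,r)$ is a coboundary Lie bialgebra; $r$ is skew symmetric.
   Context: Let $L$ be a Lie algebra over $k$. For $r=\sum_i a_i\otimes b_i\in L\otimes L$ and $x\in L$ put $x\cdot r=\sum_i([x,a_i]\otimes b_i+a_i\otimes[x,b_i])$ and $\Delta_r(x)=x\cdot r$. The element $r$ is a solution of the classical Yang–Baxter equation (CYBE) if $[r^{12},r^{13}]+[r^{12},r^{23}]+[r^{13},r^{23}]=0$ in $L\otimes L\otimes L$, where $[r^{12},r^{13}]=\sum_{i,j}[a_i,a_j]\otimes b_i\otimes b_j$, $[r^{12},r^{23}]=\sum_{i,j}a_i\otimes[b_i,a_j]\otimes b_j$, $[r^{13},r^{23}]=\sum_{i,j}a_i\otimes a_j\otimes[b_i,b_j]$. Given a basis $\{e_i\}$ of $L$, an element $r=\sum k_{ij}(e_i\otimes e_j)$ is skew symmetric if $k_{ij}=-k_{ji}$ for all $i,j$ (independent of the basis). Let $\tau(x\otimes y)=y\otimes x$ on $L\otimes L$ and $\xi(x\otimes y\otimes z)=y\otimes z\otimes x$ on $L\otimes L\otimes L$. A vector space $L$ with a linear map $\Delta:L\to L\otimes L$ is a Lie coalgebra if (i) $\operatorname{Im}\Delta\subseteq\operatorname{Im}(1-\tau)$ and (ii) $(1+\xi+\xi^2)(1\otimes\Delta)\Delta=0$.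 $(L,[\ ],\Delta)$ is a Lie bialgebra if $(L,[\ ])$ is a Lie algebra, $(L,\Delta)$ is a Lie coalgebra, and $\Delta[x,y]=x\cdot\Delta(y)-y\cdot\Delta(x)$ for all $x,y\in L$. $(L,[\ ],\Delta,r)$ is a coboundary Lie bialgebra if $(L,[\ ],\Delta)$ is a Lie bialgebra, $r\in\operatorname{Im}(1-\tau)\subseteq L\otimes L$, and $\Delta(x)=x\cdot r$ for all $x\in L$. A coboundary Lie bialgebra $(L,[\ ],\Delta,r)$ is triangular if $r$ is a solution of the CYBE. *)

(* Defs.v *)
From HB Require Import structures.
From mathcomp Require Import all_boot all_order all_algebra.

Set Implicit Arguments.
Unset Strict Implicit.
Unset Printing Implicit Defensive.
Set Warnings "-redundant-canonical-projection".

Import GRing.Theory.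
Local Open Scope ring_scope.

Reserved Notation "V ⊗ W" (at level 40, left associativity).
Reserved Notation "x ⊗t y" (at level 40, left associativity).
Reserved Notation "x ▷ t" (at level 40, no associativity).
Reserved Notation "[lie x , y ]" (format "[lie  x ,  y ]").

(* The tensor product of two finite-dimensional spaces, modelled by matrices  *)
(* of coordinates with respect to the bases vbasis {:V} and vbasis {:W}. The  *)
(* lemmas tens_bilinear, tlift_tens and tens_span show that the model has the *)
(* universal property of the tensor product.                                  *)
Section Tensor.
Variables (k : fieldType) (V W : vectType k).

Definition tensor := 'M[k]_(\dim {:V}, \dim {:W}).
HB.instance Definition _ := Vector.copy tensor (matrix k (\dim {:V}) (\dim {:W})).

Definition tens (x : V) (y : W) : tensor :=
  \matrix_(i, j) (coord (vbasis {:V}) i x * coord (vbasis {:W}) j y).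

(* The linear map tensor -> U induced by f : V -> W -> U. It depends on the   *)
(* chosen bases in general, but not when f is bilinear: see tlift_tens.       *)
Definition tlift (U : lmodType k) (f : V -> W -> U) (t : tensor) : U :=
  \sum_i \sum_j t i j *: f (vbasis {:V})`_i (vbasis {:W})`_j.

Lemma tlift_is_linear (U : lmodType k) (f : V -> W -> U) : linear (tlift f).
Proof.
move=> a s t; rewrite /tlift scaler_sumr -big_split; apply: eq_bigr => i _ /=.
rewrite scaler_sumr -big_split; apply: eq_bigr => j _ /=.
by rewrite !mxE scalerDl scalerA.
Qed.

HB.instance Definition _ (U : lmodType k) (f : V -> W -> U) :=
  GRing.isLinear.Build k tensor U *:%R (tlift f) (tlift_is_linear f).

Lemma tens_bilinear : bilinear_for *:%R *:%R tens.
Proof.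
split=> [y a x x'|x a y y']; apply/matrixP=> i j; rewrite !mxE linearP /=.
  by rewrite mulrDl mulrA.
by rewrite mulrDr mulrCA.
Qed.

Lemma tlift_tens (U : lmodType k) (f : V -> W -> U) x y :
  bilinear_for *:%R *:%R f -> tlift f (tens x y) = f x y.
Proof.
move=> [fl fr].
have sumL (I : finType) (c : I -> k) (v : I -> V) y' :
    f (\sum_i c i *: v i) y' = \sum_i c i *: f (v i) y'.
  have f0 : f 0 y' = 0.
    by apply: (addrI (f 0 y')); rewrite addr0 -{1}[f 0 y']scale1r -fl scale1r addr0.
  by elim/big_rec2: _ => // i p q _ <-; exact: fl.
have sumR (I : finType) (c : I -> k) (v : I -> W) x' :
    f x' (\sum_i c i *: v i) = \sum_i c i *: f x' (v i).
  have f0 : f x' 0 = 0.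
    by apply: (addrI (f x' 0)); rewrite addr0 -{1}[f x' 0]scale1r -fr scale1r addr0.
  by elim/big_rec2: _ => // i p q _ <-; exact: fr.
rewrite [in RHS](coord_vbasis (memvf x)) [in RHS](coord_vbasis (memvf y)) sumL.
rewrite /tlift; apply: eq_bigr => i _; rewrite sumR scaler_sumr.
by apply: eq_bigr => j _; rewrite mxE scalerA.
Qed.

Lemma tlift_sum (U : lmodType k) (f : V -> W -> U) (I : finType) a b :
  bilinear_for *:%R *:%R f ->
  tlift f (\sum_(i : I) tens (a i) (b i)) = \sum_i f (a i) (b i).
Proof.
by move=> fb; rewrite linear_sum; apply: eq_bigr => i _; exact: tlift_tens.
Qed.

Lemma tlift_linear (U : lmodType k) (f g h : V -> W -> U) c t :
  (forall x y, f x y = c *: g x y + h x y) ->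
  tlift f t = c *: tlift g t + tlift h t.
Proof.
move=> fgh; rewrite /tlift scaler_sumr -big_split; apply: eq_bigr => i _ /=.
rewrite scaler_sumr -big_split; apply: eq_bigr => j _ /=.
by rewrite fgh scalerDr !scalerA (mulrC c).
Qed.

Lemma tens_span (t : tensor) :
  t = \sum_i \sum_j t i j *: tens (vbasis {:V})`_i (vbasis {:W})`_j.
Proof.
apply/matrixP=> i j; rewrite summxE (bigD1 i) //= summxE (bigD1 j) //=.
have fV := basis_free (vbasisP {:V}); have fW := basis_free (vbasisP {:W}).
rewrite !mxE !coord_free // !eqxx !mulr1 !big1 ?addr0 //.
  move=> i' ne; rewrite summxE big1 // => j' _.
  by rewrite !mxE !coord_free // [_ == i](negbTE ne) mul0r mulr0.
by move=> j' ne; rewrite !mxE !coord_free // [_ == j](negbTE ne) !mulr0.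
Qed.

End Tensor.

Notation "V ⊗ W" := (tensor V W) : type_scope.
Notation "x ⊗t y" := (tens x y) : ring_scope.

Definition tmap (k : fieldType) (V W V' W' : vectType k)
    (f : V -> V') (g : W -> W') : V ⊗ W -> V' ⊗ W' :=
  tlift (fun x y => f x ⊗t g y).

Definition tau (k : fieldType) (V : vectType k) : V ⊗ V -> V ⊗ V :=
  tlift (fun x y => y ⊗t x).

(* V ⊗ V ⊗ V is associated to the right throughout, as V ⊗ (V ⊗ V).           *)
Definition xi (k : fieldType) (V : vectType k) :
    V ⊗ (V ⊗ V) -> V ⊗ (V ⊗ V) :=
  tlift (fun x => tlift (fun y z => y ⊗t (z ⊗t x))).

Section TensorMaps.
Variable k : fieldType.

Lemma tmap_tens (V W V' W' : vectType k) (f : {linear V -> V'})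
    (g : {linear W -> W'}) x y :
  tmap f g (x ⊗t y) = f x ⊗t g y.
Proof.
apply: (tlift_tens (f := fun x y => f x ⊗t g y)).
by split=> [w c u v|u c v w]; rewrite linearP; apply tens_bilinear.
Qed.

Lemma tau_tens (V : vectType k) (x y : V) : tau (x ⊗t y) = y ⊗t x.
Proof.
apply: (tlift_tens (f := fun x y => y ⊗t x)).
by split=> [w c u v|u c v w]; apply tens_bilinear.
Qed.

Lemma xi_tens (V : vectType k) (x y z : V) :
  xi (x ⊗t (y ⊗t z)) = y ⊗t (z ⊗t x).
Proof.
rewrite /xi tlift_tens ?tlift_tens //; split=> [w c u v|u c v w].
- by rewrite !(tens_bilinear _ _).1.
- by rewrite !(tens_bilinear _ _).1 (tens_bilinear _ _).2.
- by apply: tlift_linear => a b; rewrite !(tens_bilinear _ _).2.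
- exact: linearP.
Qed.

End TensorMaps.

Definition im_1subtau (k : fieldType) (V : vectType k) (t : V ⊗ V) : Prop :=
  exists u : V ⊗ V, t = u - tau u.

Definition lie_coalgebra (k : fieldType) (V : vectType k)
    (Delta : {linear V -> V ⊗ V}) : Prop :=
  (forall x, im_1subtau (Delta x)) /\
  (forall x, let t := tmap idfun Delta (Delta x) in t + xi t + xi (xi t) = 0).

Definition skew_symmetric (k : fieldType) (V : vectType k) (r : V ⊗ V) : Prop :=
  forall e : (\dim {:V}).-tuple V, basis_of {:V} e ->
  exists K : 'M[k]_(\dim {:V}),
    r = \sum_i \sum_j K i j *: (e`_i ⊗t e`_j)
    /\ forall i j, K i j = - K j i.

Lemma skew_symmetric_basis (k : fieldType) (V : vectType k) (r : V ⊗ V)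
    (e : (\dim {:V}).-tuple V) (K : 'M[k]_(\dim {:V})) :
  r = \sum_i \sum_j K i j *: (e`_i ⊗t e`_j) ->
  (forall i j, K i j = - K j i) -> skew_symmetric r.
Proof.
move=> -> K_skew f fB; pose P : 'M[k]_(\dim {:V}) := \matrix_(i, j) coord f j e`_i.
have eE (i : 'I_(\dim {:V})) : e`_i = \sum_j P i j *: f`_j.
  rewrite [LHS](coord_basis fB (memvf _)).
  by apply: eq_bigr => j _; rewrite mxE.
clearbody P; exists (P^T *m K *m P); split; last first.
  have KT : K^T = - K by apply/matrixP=> i j; rewrite !mxE.
  move=> i j; have <- : (P^T *m K *m P)^T j i = (P^T *m K *m P) i j by rewrite mxE.
  by rewrite !trmx_mul trmxK KT mulNmx mulmxN mulmxA mxE.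
have tensE (i j : 'I_(\dim {:V})) : e`_i ⊗t e`_j
    = \sum_a \sum_b (P i a * P j b) *: (f`_a ⊗t f`_b).
  apply/matrixP=> p q; rewrite mxE (eE i) (eE j) !linear_sum big_distrlr /=.
  rewrite summxE; apply: eq_bigr => a _; rewrite summxE; apply: eq_bigr => b _.
  by rewrite !linearZ !mxE /= mulrACA.
under eq_bigr => i _ do under eq_bigr => j _ do rewrite tensE.
transitivity (\sum_a \sum_b \sum_i \sum_j
    (P i a * K i j * P j b) *: (f`_a ⊗t f`_b)).
  under eq_bigr => i _ do under eq_bigr => j _ do rewrite scaler_sumr.
  under eq_bigr => i _ do rewrite exchange_big.
  rewrite exchange_big; apply: eq_bigr => a _ /=.
  under eq_bigr => i _ do under eq_bigr => j _ do rewrite scaler_sumr.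
  under eq_bigr => i _ do rewrite exchange_big.
  rewrite exchange_big; apply: eq_bigr => b _ /=.
  apply: eq_bigr => i _; apply: eq_bigr => j _.
  by rewrite scalerA mulrA (mulrC (K i j)).
apply: eq_bigr => a _; apply: eq_bigr => b _.
rewrite mxE scaler_suml exchange_big; apply: eq_bigr => j _ /=.
rewrite mxE mulr_suml scaler_suml; apply: eq_bigr => i _.
by rewrite mxE.
Qed.

HB.mixin Record isLieAlgebra (k : fieldType) L of Vector k L := {
  lie : L -> L -> L;
  lie_bilinear : bilinear_for *:%R *:%R lie;
  liexx : forall x, lie x x = 0;
  lie_jacobi : forall x y z,
    lie x (lie y z) + lie y (lie z x) + lie z (lie x y) = 0 }.

(* Finite-dimensional Lie algebras over k. *)
#[short(type="lieAlgType")]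
HB.structure Definition LieAlgebra (k : fieldType) :=
  { L of isLieAlgebra k L & Vector k L }.

Notation "[lie x , y ]" := (lie x y) : ring_scope.

Section LieBialgebra.
Variables (k : fieldType) (L : lieAlgType k).
Implicit Types (r t : L ⊗ L) (x y a b : L).

Definition act x : L ⊗ L -> L ⊗ L :=
  tlift (fun a b => [lie x, a] ⊗t b + a ⊗t [lie x, b]).
Local Notation "x ▷ t" := (act x t).

Lemma act_sum x (I : finType) (a b : I -> L) :
  x ▷ (\sum_i a i ⊗t b i)
    = \sum_i ([lie x, a i] ⊗t b i + a i ⊗t [lie x, b i]).
Proof.
apply: (tlift_sum (f := fun a b => [lie x, a] ⊗t b + a ⊗t [lie x, b])).
split=> [w c u v|u c v w] /=; rewrite (lie_bilinear.2 x c).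
  by rewrite !((tens_bilinear _ _).1 _ c) scalerDr addrACA.
by rewrite !((tens_bilinear _ _).2 _ c) scalerDr addrACA.
Qed.

Definition Delta_ r : L -> L ⊗ L := fun x => x ▷ r.

Lemma Delta_is_linear r : linear (Delta_ r).
Proof.
move=> a x y; rewrite /Delta_ /act /tlift scaler_sumr -big_split.
apply: eq_bigr => i _ /=; rewrite scaler_sumr -big_split.
apply: eq_bigr => j _ /=; rewrite !(lie_bilinear.1 _ a x y).
rewrite (tens_bilinear L L).1 (tens_bilinear L L).2.
by rewrite addrACA -scalerDr (scalerDr (r i j)) !scalerA (mulrC a).
Qed.

HB.instance Definition _ r :=
  GRing.isLinear.Build k L (L ⊗ L) *:%R (Delta_ r) (Delta_is_linear r).

Definition r12_r13 r : L ⊗ (L ⊗ L) :=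
  tlift (fun a b => tlift (fun a' b' => [lie a, a'] ⊗t (b ⊗t b')) r) r.
Definition r12_r23 r : L ⊗ (L ⊗ L) :=
  tlift (fun a b => tlift (fun a' b' => a ⊗t ([lie b, a'] ⊗t b')) r) r.
Definition r13_r23 r : L ⊗ (L ⊗ L) :=
  tlift (fun a b => tlift (fun a' b' => a ⊗t (a' ⊗t [lie b, b'])) r) r.

Section Expand.
Variables (I : finType) (a b : I -> L).
Let r := \sum_i a i ⊗t b i.

Lemma r12_r13_sum :
  r12_r13 r = \sum_i \sum_j [lie a i, a j] ⊗t (b i ⊗t b j).
Proof.
rewrite /r12_r13 tlift_sum; last first.
  by split=> [w c u v|u c v w]; apply: tlift_linear => p q;
    rewrite ?(lie_bilinear.1 _ c) ?((tens_bilinear _ _).1 _ c)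
            ?((tens_bilinear _ _).2 _ c).
apply: eq_bigr => i _.
rewrite (tlift_sum (f := fun p q => [lie a i, p] ⊗t (b i ⊗t q))) //.
by split=> [w c u v|u c v w]; rewrite ?(lie_bilinear.2 _ c)
  ?((tens_bilinear _ _).1 _ c) ?((tens_bilinear _ _).2 _ c).
Qed.

Lemma r12_r23_sum :
  r12_r23 r = \sum_i \sum_j a i ⊗t ([lie b i, a j] ⊗t b j).
Proof.
rewrite /r12_r23 tlift_sum; last first.
  by split=> [w c u v|u c v w]; apply: tlift_linear => p q;
    rewrite ?(lie_bilinear.1 _ c) ?((tens_bilinear _ _).1 _ c)
            ?((tens_bilinear _ _).2 _ c).
apply: eq_bigr => i _.
rewrite (tlift_sum (f := fun p q => a i ⊗t ([lie b i, p] ⊗t q))) //.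
by split=> [w c u v|u c v w]; rewrite ?(lie_bilinear.2 _ c)
  ?((tens_bilinear _ _).1 _ c) ?((tens_bilinear _ _).2 _ c).
Qed.

Lemma r13_r23_sum :
  r13_r23 r = \sum_i \sum_j a i ⊗t (a j ⊗t [lie b i, b j]).
Proof.
rewrite /r13_r23 tlift_sum; last first.
  by split=> [w c u v|u c v w]; apply: tlift_linear => p q;
    rewrite ?(lie_bilinear.1 _ c) ?((tens_bilinear _ _).1 _ c)
            ?((tens_bilinear _ _).2 _ c).
apply: eq_bigr => i _.
rewrite (tlift_sum (f := fun p q => a i ⊗t (p ⊗t [lie b i, q]))) //.
by split=> [w c u v|u c v w]; rewrite ?(lie_bilinear.2 _ c)
  ?((tens_bilinear _ _).1 _ c) ?((tens_bilinear _ _).2 _ c).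
Qed.

End Expand.

Definition CYBE r : Prop := r12_r13 r + r12_r23 r + r13_r23 r = 0.

Definition lie_bialgebra (Delta : {linear L -> L ⊗ L}) : Prop :=
  lie_coalgebra Delta /\
  (forall x y, Delta [lie x, y] = x ▷ Delta y - y ▷ Delta x).

Definition coboundary_lie_bialgebra (Delta : {linear L -> L ⊗ L}) r : Prop :=
  [/\ lie_bialgebra Delta, im_1subtau r & forall x, Delta x = x ▷ r].

Definition triangular_lie_bialgebra (Delta : {linear L -> L ⊗ L}) r : Prop :=
  coboundary_lie_bialgebra Delta r /\ CYBE r.

End LieBialgebra.

Notation "x ▷ t" := (act x t) : ring_scope.

(* Main.v *)
Require Import Defs.
From HB Require Import structures.
From mathcomp Require Import all_boot all_order all_algebra.
Local Open Scope ring_scope.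

Set Implicit Arguments.
Unset Strict Implicit.
Unset Printing Implicit Defensive.

Import GRing.Theory.

(** An element of the image of 1 - τ is skew symmetric, and conversely, when 2
    is invertible and L has basis (e_0, e_1), a skew symmetric r is a multiple
    of e_0 ∧ e_1 (lemma [skew_plane]). So what has to be shown is that r = u ∧ v,
    with u a multiple of e_0 and v = e_1, gives a triangular Lie bialgebra.

    The cocycle condition for Δ_r holds for every r, because L ⊗ L is an
    L-module (lemma [act_lie]). The other two conditions reduce to the vanishing
    of alternating 3-tensors on a plane (lemma [wedge3_plane]). Put w = [u, v],
    which lies in the span of u and v even if u = 0. The left-hand side of the
    classical Yang-Baxter equation for u ∧ v is the full antisymmetrisation of
    w ⊗ u ⊗ v (lemma [CYBE_wedge]), hence zero. For the co-Jacobi identity, L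
    acts on the line spanned by e_0 ∧ e_1 by scalars (the trace of the adjoint
    action), so that Δ_r(x) is a multiple of r; and (1 ⊗ Δ_r) r = - w ⊗ r, whose
    cyclic sum is again the antisymmetrisation of w, u, v up to sign (lemma
    [lie_coalgebra_wedge]). *)

(** * Linearity of the tensor operations *)

HB.instance Definition _ (k : fieldType) (V W : vectType k) :=
  bilinear_isBilinear.Build k V W (V ⊗ W) *:%R *:%R (@tens k V W)
    (tens_bilinear V W).

HB.instance Definition _ (k : fieldType) (L : lieAlgType k) :=
  bilinear_isBilinear.Build k L L L *:%R *:%R (@lie k L) lie_bilinear.

HB.instance Definition _ (k : fieldType) (V W V' W' : vectType k)
    (f : V -> V') (g : W -> W') :=
  GRing.isLinear.Build k (V ⊗ W) (V' ⊗ W') *:%R (tmap f g)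
    (tlift_is_linear _).

HB.instance Definition _ (k : fieldType) (V : vectType k) :=
  GRing.isLinear.Build k (V ⊗ V) (V ⊗ V) *:%R (@tau k V)
    (tlift_is_linear _).

HB.instance Definition _ (k : fieldType) (V : vectType k) :=
  GRing.isLinear.Build k (V ⊗ (V ⊗ V)) (V ⊗ (V ⊗ V)) *:%R (@xi k V)
    (tlift_is_linear _).

HB.instance Definition _ (k : fieldType) (L : lieAlgType k) (x : L) :=
  GRing.isLinear.Build k (L ⊗ L) (L ⊗ L) *:%R (act x) (tlift_is_linear _).

Lemma tens_ind (k : fieldType) (V W : vectType k) (P : V ⊗ W -> Prop) :
  P 0 -> (forall c s t, P s -> P t -> P (c *: s + t)) ->
  (forall x y, P (x ⊗t y)) -> forall t, P t.
Proof.
move=> P0 Plin Ptens t; rewrite [t]tens_span.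
have PD s s' : P s -> P s' -> P (s + s') by rewrite -{2}[s]scale1r; exact: Plin.
apply: big_ind => // i _; apply: big_ind => // j _.
by rewrite -[_ *: _]addr0; exact: Plin.
Qed.

(** * Exterior products inside tensor powers *)

(** Locked: otherwise the rewriting rules for bilinear maps unfold it when they
    look for a tensor of a sum. *)
HB.lock Definition wedge (k : fieldType) (V : vectType k) (x y : V) : V ⊗ V :=
  x ⊗t y - y ⊗t x.

Section Wedge.
Variables (k : fieldType) (V : vectType k).
Implicit Types (u v w x y z : V).

Lemma wedgeE x y : wedge x y = x ⊗t y - y ⊗t x.
Proof. by rewrite unlock. Qed.

Lemma wedge_bilinear : bilinear_for *:%R *:%R (@wedge k V).
Proof.
split=> [w c u v|u c v w] /=; rewrite !wedgeE linearPl linearPr /=;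
  by rewrite scalerBr opprD addrACA.
Qed.

HB.instance Definition _ :=
  bilinear_isBilinear.Build k V V (V ⊗ V) *:%R *:%R (@wedge k V) wedge_bilinear.

Lemma wedgexx x : wedge x x = 0.
Proof. by rewrite wedgeE subrr. Qed.

Lemma wedgeC x y : wedge y x = - wedge x y.
Proof. by rewrite !wedgeE opprB. Qed.

Lemma im_1subtau_wedge c x y : im_1subtau (c *: wedge x y).
Proof.
by exists (c *: (x ⊗t y)); rewrite linearZ /= tau_tens wedgeE -scalerBr.
Qed.

(** This is the sum of the signed permutations of u ⊗ v ⊗ w, i.e. u ∧ v ∧ w as
    an antisymmetric tensor. *)
Definition wedge3 u v w : V ⊗ (V ⊗ V) :=
  u ⊗t wedge v w + v ⊗t wedge w u + w ⊗t wedge u v.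

Lemma wedge3_lin c d p q u v :
  wedge3 (c *: p + d *: q) u v = c *: wedge3 p u v + d *: wedge3 q u v.
Proof.
rewrite /wedge3 !linearDl !linearDr /= !linearZl_LR !linearZr_LR /=.
by rewrite (addrACA (c *: _) (d *: _)) [LHS]addrACA !scalerDr.
Qed.

(** By linearity it suffices that an alternating tensor vanishes when two of
    its three vectors coincide. *)
Lemma wedge3_plane c d u v : wedge3 (c *: u + d *: v) u v = 0.
Proof.
rewrite wedge3_lin /wedge3 !wedgexx !linear0r !addr0.
by rewrite (wedgeC u v) !linearNr /= !subrr !scaler0 addr0.
Qed.

(** The last two factors are antisymmetric already, so the cyclic sum of the
    co-Jacobi identity reaches all six permutations with their signs. *)
Lemma cyclic_sum_wedge u v w (t := u ⊗t wedge v w) :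
  t + xi t + xi (xi t) = wedge3 u v w.
Proof.
rewrite /t /wedge3 !wedgeE !linearBr /= !linearB /= !xi_tens.
set a := u ⊗t _; set a' := u ⊗t _; set b := v ⊗t _; set b' := w ⊗t _.
set c := w ⊗t _; set c' := v ⊗t _.
by rewrite -[LHS]addrA -[RHS]addrA; congr (_ + _);
  rewrite addrACA [RHS]addrACA [- b' - c']addrC.
Qed.

(** * Skew symmetric tensors *)

Lemma tau_trmx (t : V ⊗ V) : tau t = t^T :> 'M_(_).
Proof.
rewrite [t in LHS]tens_span [t in RHS]tens_span linear_sum /=.
apply/matrixP=> p q; rewrite !mxE !summxE; apply: eq_bigr => i _.
rewrite linear_sum /= !summxE; apply: eq_bigr => j _.
by rewrite linearZ /= tau_tens !mxE (mulrC (coord _ _ _)).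
Qed.

Lemma im_1subtau_skew (r : V ⊗ V) : im_1subtau r -> skew_symmetric r.
Proof.
move=> [u ->]; apply: (skew_symmetric_basis (tens_span _)) => i j.
by rewrite tau_trmx !mxE opprB.
Qed.

(** Skew symmetry kills the diagonal coefficients (2 is invertible) and pairs
    the other two. The size is a variable n, equal to 2, so that it can be
    instantiated with the dimension of V, on which the type of tensors
    depends. *)
Lemma skew_sum_plane n (n2 : n = 2%N) (e : nat -> V) (K : 'M[k]_n) :
  2%N \notin [pchar k] -> (forall i j, K i j = - K j i) ->
  exists c, \sum_i \sum_j K i j *: (e i ⊗t e j) = c *: wedge (e 0%N) (e 1%N).
Proof.
move=> char2 Kskew; subst n; exists (K ord0 ord_max).
have Kdiag i : K i i = 0.
  apply/eqP; have /eqP := Kskew i i; rewrite -addr_eq0 -mulr2n -mulr_natl.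
  by rewrite mulf_eq0 => /orP[/eqP two0|//]; case/negP: char2; rewrite inE /= two0.
have -> : ord_max = lift ord0 ord0 :> 'I_2 by apply: val_inj.
rewrite !big_ord_recl !big_ord0 !Kdiag !scale0r !addr0 add0r /=.
by rewrite [K (lift _ _) _]Kskew scaleNr -scalerBr wedgeE.
Qed.

Lemma skew_plane (r : V ⊗ V) (e := vbasis {:V}) :
  2%N \notin [pchar k] -> \dim {:V} = 2%N -> skew_symmetric r ->
  exists c, r = c *: wedge e`_0 e`_1.
Proof.
move=> char2 dim2 /(_ e (vbasisP _)) [K [-> Kskew]].
exact: (skew_sum_plane dim2 (nth 0 e)).
Qed.

Lemma plane_span (x : V) (e := vbasis {:V}) : \dim {:V} = 2%N ->
  exists c d, x = c *: e`_0 + d *: e`_1.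
Proof.
move=> dim2; have span2 n (c : 'I_n -> k) : n = 2%N ->
    exists a b, \sum_i c i *: e`_i = a *: e`_0 + b *: e`_1.
  move=> n2; subst n; exists (c ord0), (c (lift ord0 ord0)).
  by rewrite !big_ord_recl big_ord0 addr0.
by rewrite [x](coord_vbasis (memvf x)); exact: span2.
Qed.

(** When u and v form a basis, the scalar is the trace of f; for f = ad x this
    makes the exterior square of a plane a one-dimensional L-module. *)
Lemma wedge_derivation_plane (f : V -> V) (u v : V) :
  (exists c d, f u = c *: u + d *: v) -> (exists c d, f v = c *: u + d *: v) ->
  exists c, wedge (f u) v + wedge u (f v) = c *: wedge u v.
Proof.
move=> [c [d ->]] [c' [d' ->]]; exists (c + d').
rewrite linearDl linearDr /= !linearZl_LR !linearZr_LR /= !wedgexx.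
by rewrite !scaler0 addr0 add0r scalerDl.
Qed.

End Wedge.

(** * The bialgebra structure *)

Section Coboundary.
Variables (k : fieldType) (L : lieAlgType k).
Implicit Types (r t : L ⊗ L) (u v w x y : L).

Lemma lieC x y : [lie y, x] = - [lie x, y].
Proof.
apply/eqP; rewrite -addr_eq0; apply/eqP; have := liexx (x + y).
by rewrite linearDl !linearDr /= !liexx addr0 add0r addrC.
Qed.

Lemma act_tens x u v : x ▷ (u ⊗t v) = [lie x, u] ⊗t v + u ⊗t [lie x, v].
Proof.
by have := act_sum x (fun _ : 'I_1 => u) (fun _ => v); rewrite !big_ord1.
Qed.

Lemma act_wedge x u v :
  x ▷ wedge u v = wedge [lie x, u] v + wedge u [lie x, v].
Proof.
rewrite !wedgeE linearB /= !act_tens.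
by rewrite [_ + v ⊗t _]addrC opprD addrACA.
Qed.

Lemma lie_lie x y u :
  [lie [lie x, y], u] = [lie x, [lie y, u]] - [lie y, [lie x, u]].
Proof.
have /eqP := lie_jacobi x y u; rewrite addr_eq0 => /eqP xyu.
by rewrite -linearNr /= -lieC xyu -lieC.
Qed.

(** This is the Jacobi identity on each tensor factor, the mixed terms
    cancelling. For the coboundary Δ_t it is exactly the cocycle condition. *)
Lemma act_lie x y t : [lie x, y] ▷ t = x ▷ (y ▷ t) - y ▷ (x ▷ t).
Proof.
elim/tens_ind: t => [|c s t IHs IHt|u v]; first by rewrite !linear0 addr0.
  by rewrite !linearD !linearZ /= IHs IHt scalerDr addrACA.
rewrite !act_tens !linearD /= !act_tens !lie_lie.
rewrite linearBl linearBr /=.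
set p := _ ⊗t v; set p' := _ ⊗t v; set q := u ⊗t _; set q' := u ⊗t _.
set s := _ ⊗t _; set s' := _ ⊗t _.
rewrite -opprD [s' + q]addrC [s + q']addrC [p + s + _]addrACA.
rewrite [p' + s' + _]addrACA [s' + s]addrC opprD [RHS]addrACA subrr addr0.
by rewrite addrACA opprD.
Qed.

(** Since [u, u] = [v, v] = 0, each of the three brackets of the equation has
    two surviving terms; together they are the six terms of [u, v] ∧ u ∧ v, and
    these three vectors are coplanar. *)
Lemma CYBE_wedge u v c d : [lie u, v] = c *: u + d *: v -> CYBE (wedge u v).
Proof.
move=> uvE; rewrite /CYBE.
have -> : wedge u v =
    \sum_(b : bool) (if b then u else - v) ⊗t (if b then v else u).
  by rewrite big_bool wedgeE linearNl.
rewrite r12_r13_sum r12_r23_sum r13_r23_sum !big_bool /=.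
rewrite !(linearNl, linearNr) /= ?liexx ?(lieC u v).
rewrite !(linearNl, linearNr, linear0l, linear0r) /= !(opprK, oppr0, addr0, add0r).
rewrite -[RHS](wedge3_plane c d u v) -uvE /wedge3 !wedgeE !linearBr /=.
rewrite -[LHS]addrA -[RHS]addrA [X in _ + X = _]addrACA.
by congr (_ + (_ + _)); exact: addrC.
Qed.

(** Write w = [u, v]. Then u · r = u ∧ w = d r and v · r = - w ∧ v = - c r, so
    (1 ⊗ Δ) r = u ⊗ (v · r) - v ⊗ (u · r) = - w ⊗ r, whose cyclic sum is
    - w ∧ u ∧ v = 0. As Δ(x) is a multiple of r, that suffices. *)
Lemma lie_coalgebra_wedge u v c d (r := wedge u v) :
  [lie u, v] = c *: u + d *: v -> (forall x, exists l, x ▷ r = l *: r) ->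
  lie_coalgebra (Delta_ r).
Proof.
move=> uvE r_eigen; have DeltaE x : Delta_ r x = x ▷ r by [].
split=> x; have [l xr] := r_eigen x; rewrite /= DeltaE xr.
  exact: im_1subtau_wedge.
rewrite linearZ /=.
have ur : u ▷ r = d *: r.
  rewrite act_wedge liexx linear0l add0r uvE linearDr /= !linearZr_LR /=.
  by rewrite wedgexx scaler0 add0r.
have vr : v ▷ r = - c *: r.
  rewrite act_wedge liexx linear0r addr0 lieC uvE linearNl /= linearDl /=.
  by rewrite !linearZl_LR /= wedgexx scaler0 addr0 scaleNr.
have -> : tmap idfun (Delta_ r) r = - ([lie u, v] ⊗t r).
  rewrite [X in tmap _ _ X]wedgeE linearB /= !(tmap_tens idfun) /= !DeltaE ur vr.
  by rewrite !linearZr_LR /= uvE linearDl /= !linearZl_LR /= scaleNr opprD.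
rewrite !linearN /= !linearZ /= -!linearD /=.
by rewrite cyclic_sum_wedge uvE wedge3_plane oppr0 scaler0.
Qed.

Lemma triangular_skew_plane r : 2%N \notin [pchar k] -> \dim {:L} = 2%N ->
  skew_symmetric r -> triangular_lie_bialgebra (Delta_ r) r.
Proof.
move=> char2 dim2 /(skew_plane char2 dim2) [s ->]; set e := vbasis _.
have span x := plane_span x dim2; rewrite -/e in span.
rewrite -linearZl_LR /=.
(* The coefficient goes into the first vector, so that r is exactly u ∧ v. *)
set u := s *: e`_0; set v := e`_1.
have [c [d uvE]] : exists c d, [lie u, v] = c *: u + d *: v.
  have [c [d abE]] := span [lie e`_0, e`_1]; exists c, (s * d).
  by rewrite linearZl_LR /= abE scalerDr !scalerA (mulrC s).
split; last exact: CYBE_wedge uvE.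
split; [split | by rewrite -[wedge _ _]scale1r; exact: im_1subtau_wedge | by []].
  apply: (lie_coalgebra_wedge uvE) => x.
  have [l xe] := wedge_derivation_plane (span [lie x, e`_0]) (span [lie x, e`_1]).
  by exists l; rewrite linearZl_LR linearZ /= act_wedge xe !scalerA mulrC.
by move=> x y; rewrite /= /Delta_ act_lie.
Qed.

End Coboundary.

Theorem theorem2p4 (k : fieldType) (L : lieAlgType k) (r : L ⊗ L) :
  2%N \notin [pchar k] -> \dim {:L} = 2%N ->
  [<-> triangular_lie_bialgebra (Delta_ r) r;
       coboundary_lie_bialgebra (Delta_ r) r;
       skew_symmetric r].
Proof.
move=> char2 dim2; tfae; first by case.
- by case=> _ /im_1subtau_skew.
- exact: triangular_skew_plane.
Qed.
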